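(* Let $\mathbf A\in\mathbb R^{n\times n}$ be a nonzero singular skew-symmetric matrix and let $\mathbf b\in\mathbb R^n$ be nonzero. Let $\mathbf x_j^{\rm M}$ and $\mathbf x_j^{\rm LSQR}$ be the $j$th iterates of S$^2$MR and LSQR for $\mathbf A\mathbf x=\mathbf b$, respectively. For each $j\ge 1$ with $\mathbf x_j^{\rm LSQR}\neq\mathbf A^\dagger\mathbf b$ (i.e., LSQR does not converge at the $j$th iteration), we have $\mathbf x_{2j}^{\rm M}=\mathbf x_{2j+1}^{\rm M}=\mathbf x_j^{\rm LSQR}$. Moreover, whether $\mathbf A\mathbf x=\mathbf b$ is consistent or not, S$^2$MR always returns the pseudoinverse solution $\mathbf A^\dagger\mathbf b$.
   Context: Exact arithmetic and zero initial approximation ($\mathbf x_0^{\rm M}=\mathbf x_0^{\rm LSQR}=\mathbf 0$) are assumed. $\mathbf A^\dagger$ is the Moore--Penrose pseudoinverse. $\mathcal K_k(\mathbf A,\mathbf b)=\mathrm{span}\{\mathbf b,\mathbf A\mathbf b,\dots,\mathbf A^{k-1}\mathbf b\}$, and $\ell=\max_k\dim\mathcal K_k(\mathbf A,\mathbf b)$. S$^2$MR: the $k$th iterate is the minimum residual approximation $\mathbf x_k^{\rm M}=\mathrm{argmin}_{\mathbf x\in\mathcal K_k(\mathbf A,\mathbf b)}\|\mathbf b-\mathbf A\mathbf x\|_2$, which is uniquely determined for $k\le\ell-1$, and also for $k=\ell$ when $\ell$ is even. The method stops at the first index $k\ge 0$ at which $\mathbf x_k^{\rm M}$ is a least-squares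 solution, i.e. a minimizer of $\|\mathbf b-\mathbf A\mathbf x\|_2$ over all of $\mathbb R^n$, and returns that $\mathbf x_k^{\rm M}$. LSQR: the $j$th iterate is $\mathbf x_j^{\rm LSQR}=\mathrm{argmin}_{\mathbf x\in\mathcal K_j(\mathbf A^\top\mathbf A,\mathbf A^\top\mathbf b)}\|\mathbf b-\mathbf A\mathbf x\|_2$ (the minimizer is unique). *)

(* Defs.v *)
From HB Require Import structures.
From mathcomp Require Import all_boot all_order all_algebra.
From mathcomp Require Import reals.

Set Implicit Arguments.
Unset Strict Implicit.
Unset Printing Implicit Defensive.

Import Order.TTheory GRing.Theory Num.Theory.
Local Open Scope ring_scope.

(* The canonical norm of MathComp-Analysis on matrices is the sup norm, hence
   this explicit Euclidean norm. *)
Definition norm2 (R : realType) (n : nat) (v : 'cV[R]_n) : R :=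
  Num.sqrt (\sum_i v i 0 ^+ 2).

(* The four Penrose equations: they have exactly one solution X. *)
Definition is_pinv (R : realType) (m n : nat)
    (A : 'M[R]_(m, n)) (X : 'M[R]_(n, m)) : Prop :=
  [/\ A *m X *m A = A, X *m A *m X = X,
      (A *m X)^T = A *m X & (X *m A)^T = X *m A].

(* krylov B c 0 is the zero subspace. *)
Definition krylov (R : realType) (n : nat) (B : 'M[R]_n) (c : 'cV[R]_n)
    (k : nat) : {vspace 'cV[R]_n} :=
  <<[seq B ^+ i *m c | i <- iota 0 k]>>%VS.

(* x is a minimizer over S; uniqueness is not part of the predicate. *)
Definition min_residual (R : realType) (n : nat) (A : 'M[R]_n) (b : 'cV[R]_n)
    (S : {vspace 'cV[R]_n}) (x : 'cV[R]_n) : Prop :=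
  x \in S /\
  forall y : 'cV[R]_n, y \in S -> norm2 (b - A *m x) <= norm2 (b - A *m y).

Definition least_squares (R : realType) (n : nat) (A : 'M[R]_n)
    (b x : 'cV[R]_n) : Prop :=
  forall y : 'cV[R]_n, norm2 (b - A *m x) <= norm2 (b - A *m y).

(* A sequence of minimum residual approximations exists for every A and b.
   When A is skew-symmetric, its term of index k is determined by A and b if
   k < l, or if k = l is even, where l is the largest dimension of
   krylov A b k; any minimizer is allowed at the other indices. *)
Definition S2MR_iterates (R : realType) (n : nat) (A : 'M[R]_n) (b : 'cV[R]_n)
    (xM : nat -> 'cV[R]_n) : Prop :=
  forall k : nat, min_residual A b (krylov A b k) (xM k).

Definition LSQR_iterates (R : realType) (n : nat) (A : 'M[R]_n) (b : 'cV[R]_n)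
    (xL : nat -> 'cV[R]_n) : Prop :=
  forall j : nat, min_residual A b (krylov (A^T *m A) (A^T *m b) j) (xL j).

Definition S2MR_returns (R : realType) (n : nat) (A : 'M[R]_n) (b : 'cV[R]_n)
    (xM : nat -> 'cV[R]_n) (x : 'cV[R]_n) : Prop :=
  exists k : nat,
    [/\ least_squares A b (xM k),
        forall i : nat, (i < k)%N -> ~ least_squares A b (xM i)
      & x = xM k].

(* Main.v *)
Require Import Defs.
From HB Require Import structures.
From mathcomp Require Import all_boot all_order all_algebra.
From mathcomp Require Import reals.
From mathcomp Require Import ring lra.

Set Implicit Arguments.
Unset Strict Implicit.
Unset Printing Implicit Defensive.

Import Order.TTheory GRing.Theory Num.Theory.
Local Open Scope ring_scope.

(** Write G = A^T A = - A A, and let E_j = span {b, G b, ..., G^(j-1) b} and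
    O_j = A E_j. The Krylov subspaces of A split as K_(2j) = E_j + O_j and
    K_(2j+1) = E_(j+1) + O_j (skew_krylov_split), and O_j is the j-th subspace
    used by LSQR (skew_krylov_normal). Since A G^m is skew-symmetric, its
    quadratic form vanishes, whence E_i and O_j are orthogonal
    (skew_krylov_perp).

    For x = e + o with e in an even and o in an odd part, b - A o lies in an
    even part and A e in an odd one, so that
    |b - A x|^2 = |b - A o|^2 + |A e|^2. Hence a minimizer over a Krylov
    subspace of A is e + o where A e = 0 and o is a minimizer over O_j
    (skew_minimizer_split). The latter is unique, because two minimizers have
    the same image under A and O_j lies in the row space of A: it is the LSQR
    iterate.

    It remains to show e = 0. If e is a nonzero element of E_(j+1) in the
    kernel of A, then e = c b + G w with w in E_j; here c is nonzero, since
    A G w = 0 forces G w = 0, and A w / c is an element of O_j whose residual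
    e / c is in the kernel of A^T: a least-squares solution
    (skew_even_kernel). An element of the row space that is a least-squares
    solution is the pseudoinverse solution (pinv_row_space_unique). Thus e = 0
    as long as LSQR has not converged. At the index where the method stops,
    e = 0 as well, since otherwise an earlier even iterate would already be a
    least-squares solution. The method does stop: if no O_j contained a
    least-squares solution, the dimension of E_j would be unbounded
    (skew_odd_least_squares). *)

(** * The Euclidean inner product *)

(** The inner product u^T v, as the entry of a matrix of size 1. *)
Definition dot (R : realType) (n : nat) (u v : 'cV[R]_n) : R := (u^T *m v) 0 0.

Lemma dotC (R : realType) (n : nat) (u v : 'cV[R]_n) : dot u v = dot v u.
Proof.
rewrite /dot; have -> : u^T *m v = (v^T *m u)^T by rewrite trmx_mul trmxK.
by rewrite mxE.
Qed.

Lemma dotDl (R : realType) (n : nat) (u v w : 'cV[R]_n) :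
  dot (u + v) w = dot u w + dot v w.
Proof. by rewrite /dot linearD /= mulmxDl mxE. Qed.

Lemma dotZl (R : realType) (n : nat) (a : R) (u w : 'cV[R]_n) :
  dot (a *: u) w = a * dot u w.
Proof. by rewrite /dot linearZ /= -scalemxAl mxE. Qed.

Lemma dotDr (R : realType) (n : nat) (u v w : 'cV[R]_n) :
  dot w (u + v) = dot w u + dot w v.
Proof. by rewrite dotC dotDl !(dotC w). Qed.

Lemma dotZr (R : realType) (n : nat) (a : R) (u w : 'cV[R]_n) :
  dot w (a *: u) = a * dot w u.
Proof. by rewrite dotC dotZl dotC. Qed.

Lemma dotNl (R : realType) (n : nat) (u w : 'cV[R]_n) :
  dot (- u) w = - dot u w.
Proof. by rewrite -scaleN1r dotZl mulN1r. Qed.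

Lemma dotNr (R : realType) (n : nat) (u w : 'cV[R]_n) :
  dot w (- u) = - dot w u.
Proof. by rewrite dotC dotNl dotC. Qed.

Lemma dot_mull (R : realType) (m n : nat) (M : 'M[R]_(m, n))
    (u : 'cV[R]_n) (v : 'cV[R]_m) :
  dot (M *m u) v = dot u (M^T *m v).
Proof. by rewrite /dot trmx_mul mulmxA. Qed.

Lemma dot_sqr (R : realType) (n : nat) (u : 'cV[R]_n) :
  dot u u = \sum_i u i 0 ^+ 2.
Proof. by rewrite /dot mxE; apply: eq_bigr => i _; rewrite mxE expr2. Qed.

Lemma dot_ge0 (R : realType) (n : nat) (u : 'cV[R]_n) : 0 <= dot u u.
Proof. by rewrite dot_sqr; apply: sumr_ge0 => i _; apply: sqr_ge0. Qed.

Lemma dot_eq0 (R : realType) (n : nat) (u : 'cV[R]_n) :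
  (dot u u == 0) = (u == 0).
Proof.
apply/idP/eqP => [|->]; last by rewrite /dot mulmx0 mxE.
rewrite dot_sqr psumr_eq0 => [/allP u0|i _]; last exact: sqr_ge0.
apply/colP => i; rewrite mxE; apply/eqP.
by rewrite -sqrf_eq0; apply: u0; rewrite mem_index_enum.
Qed.

Lemma ler_norm2 (R : realType) (n : nat) (u v : 'cV[R]_n) :
  (norm2 u <= norm2 v) = (dot u u <= dot v v).
Proof. by rewrite /norm2 -!dot_sqr ler_sqrt // dot_ge0. Qed.

Lemma mulmx_tr_eq0 (R : realType) (m n : nat) (M : 'M[R]_(m, n))
    (u : 'cV[R]_n) : M^T *m (M *m u) = 0 -> M *m u = 0.
Proof.
move=> MTMu; apply/eqP; rewrite -dot_eq0 dot_mull MTMu.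
by rewrite /dot mulmx0 mxE.
Qed.

(** * Minimizers of the residual *)

(** Strict convexity: the midpoint of two minimizers with distinct images would
    have a smaller residual. *)
Lemma min_residual_image_unique (R : realType) (n : nat) (A : 'M[R]_n)
    (b x y : 'cV[R]_n) (S : {vspace 'cV[R]_n}) :
  min_residual A b S x -> min_residual A b S y -> A *m x = A *m y.
Proof.
move=> [xS xmin] [yS ymin].
have xy := xmin _ yS; have yx := ymin _ xS.
have zS : 2^-1 *: (x + y) \in S by rewrite rpredZ // rpredD.
have := xmin _ zS; move: xy yx; rewrite !ler_norm2.
set r := b - A *m x; set d := A *m x - A *m y.
have -> : b - A *m y = r + d.
  by rewrite /r /d addrA subrK.
have -> : b - A *m (2^-1 *: (x + y)) = r + 2^-1 *: d.
  rewrite -scalemxAr mulmxDr /r /d; move: (A *m x) (A *m y) => p q.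
  by apply/colP => i; rewrite !mxE; field.
move=> xy yx xz; apply/eqP; rewrite -subr_eq0 -dot_eq0 -/d.
move: xy yx xz; move: r d => r d.
rewrite !(dotDl, dotDr, dotZl, dotZr) (dotC d r) => xy yx xz.
by rewrite eq_le dot_ge0 andbT; lra.
Qed.

Lemma min_residual_fullv (R : realType) (n : nat) (A : 'M[R]_n)
    (b x : 'cV[R]_n) : min_residual A b fullv x <-> least_squares A b x.
Proof.
split=> [[_ xmin] y|xmin]; first by apply: xmin; rewrite memvf.
by split=> [|y _]; [rewrite memvf | apply: xmin].
Qed.

Lemma least_squares_min_residual (R : realType) (n : nat) (A : 'M[R]_n)
    (b x y : 'cV[R]_n) (S : {vspace 'cV[R]_n}) :
  least_squares A b y -> y \in S -> min_residual A b S x ->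
  least_squares A b x.
Proof.
by move=> yLS yS [_ xmin] z; apply: le_trans (xmin _ yS) (yLS z).
Qed.

(** The normal equation makes the residual orthogonal to the column space. *)
Lemma normal_eq_least_squares (R : realType) (n : nat) (A : 'M[R]_n)
    (b x : 'cV[R]_n) : A^T *m (b - A *m x) = 0 -> least_squares A b x.
Proof.
move=> normal y; rewrite ler_norm2.
have -> : b - A *m y = (b - A *m x) + A *m (x - y).
  by rewrite mulmxBr addrA subrK.
set r := b - A *m x; set d := A *m (x - y).
have rd : dot d r = 0 by rewrite dot_mull normal /dot mulmx0 mxE.
move: r d rd => r d rd.
rewrite !(dotDl, dotDr) (dotC r d) rd addr0 add0r lerDl; exact: dot_ge0.
Qed.

Lemma pinv_least_squares (R : realType) (n : nat) (A X : 'M[R]_n)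
    (b : 'cV[R]_n) : is_pinv A X -> least_squares A b (X *m b).
Proof.
case=> AXA _ AXT _; apply: normal_eq_least_squares.
have AT : A^T *m (A *m X) = A^T by rewrite -{1}AXT -trmx_mul AXA.
by rewrite mulmxBr !mulmxA -(mulmxA A^T) AT subrr.
Qed.

(** Among the least-squares solutions, the pseudoinverse solution is the only
    one in the row space. *)
Lemma pinv_row_space_unique (R : realType) (n : nat) (A X : 'M[R]_n)
    (b z : 'cV[R]_n) :
  is_pinv A X -> least_squares A b (A^T *m z) -> A^T *m z = X *m b.
Proof.
move=> pX zLS; have XLS := pinv_least_squares b pX.
case: pX => _ XAX _ XAT.
have /min_residual_image_unique E : min_residual A b fullv (A^T *m z).
  exact/min_residual_fullv.
have {}E : A *m (A^T *m z) = A *m (X *m b) by apply/E/min_residual_fullv.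
have Xb : X *m b = A^T *m (X^T *m (X *m b)).
  by rewrite mulmxA -trmx_mul XAT mulmxA XAX.
apply/eqP; rewrite -subr_eq0 Xb -mulmxBr; apply/eqP/mulmx_tr_eq0.
by rewrite trmxK mulmxBr mulmxBr -Xb E subrr.
Qed.

(** * Krylov subspaces *)

(** Left multiplication by a matrix, as a linear map on column vectors. *)
Definition mulL (R : realType) (m n : nat) (M : 'M[R]_(m, n)) :
  'Hom('cV[R]_n, 'cV[R]_m) := linfun (mulmx M).

Lemma mulLE (R : realType) (m n : nat) (M : 'M[R]_(m, n)) (u : 'cV[R]_n) :
  mulL M u = M *m u.
Proof. by rewrite lfunE. Qed.

Lemma memv_mulL (R : realType) (m n : nat) (M : 'M[R]_(m, n)) (u : 'cV[R]_n)
    (U : {vspace 'cV[R]_n}) : u \in U -> M *m u \in (mulL M @: U)%VS.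
Proof. by rewrite -mulLE; apply: memv_img. Qed.

Lemma mulL_comp (R : realType) (m n p : nat) (M : 'M[R]_(m, n))
    (N : 'M[R]_(n, p)) (U : {vspace 'cV[R]_p}) :
  (mulL M @: (mulL N @: U) = mulL (M *m N) @: U)%VS.
Proof.
rewrite -limg_comp; congr (_ @: _)%VS.
by apply/lfunP => u; rewrite comp_lfunE !mulLE mulmxA.
Qed.

Lemma mulLN (R : realType) (m n : nat) (M : 'M[R]_(m, n))
    (U : {vspace 'cV[R]_n}) : (mulL (- M) @: U = mulL M @: U)%VS.
Proof.
apply/eqP; rewrite eqEsubv; apply/andP; split; apply/subvP => _ /memv_imgP[u uU ->].
  by rewrite mulLE mulNmx -mulmxN memv_mulL // rpredN.
by rewrite mulLE -[M *m u]opprK -mulNmx -mulmxN memv_mulL // rpredN.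
Qed.

Lemma krylovS (R : realType) (n : nat) (B : 'M[R]_n) (c : 'cV[R]_n) (k : nat) :
  krylov B c k.+1 = (<[c]> + mulL B @: krylov B c k)%VS.
Proof.
rewrite /krylov /= span_cons expr0 mul1mx limg_span -map_comp (iotaDl 1%N) -map_comp.
congr (_ + <<_>>)%VS; apply: eq_map => i /=.
by rewrite mulLE add1n exprS mulmxA.
Qed.

Lemma krylov0 (R : realType) (n : nat) (B : 'M[R]_n) (c : 'cV[R]_n) :
  krylov B c 0 = 0%VS.
Proof. exact: span_nil. Qed.

Lemma krylov_leS (R : realType) (n : nat) (B : 'M[R]_n) (c : 'cV[R]_n)
    (k : nat) : (krylov B c k <= krylov B c k.+1)%VS.
Proof.
elim: k => [|k IHk]; first by rewrite krylov0 sub0v.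
by rewrite (krylovS B c k) krylovS addvS ?limgS.
Qed.

Lemma krylov_img (R : realType) (n : nat) (B M : 'M[R]_n) (c : 'cV[R]_n)
    (k : nat) : M *m B = B *m M ->
  krylov B (M *m c) k = (mulL M @: krylov B c k)%VS.
Proof.
move=> MB; elim: k => [|k IHk]; first by rewrite !krylov0 limg0.
by rewrite !krylovS IHk limgD limg_line mulLE !mulL_comp MB.
Qed.

(** With krylovS, the image of the k-th subspace has the same dimension, and the
    line spanned by c is added to it. *)
Lemma krylov_dim_growth (R : realType) (n : nat) (B : 'M[R]_n) (c : 'cV[R]_n)
    (k : nat) :
  (krylov B c k :&: lker (mulL B) = 0)%VS ->
  c \notin (mulL B @: krylov B c k)%VS ->
  \dim (krylov B c k.+1) = (\dim (krylov B c k)).+1.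
Proof.
move=> inj cN; rewrite krylovS dimv_disjoint_sum.
  rewrite dim_vline limg_dim_eq //.
  by case: eqP cN => // ->; rewrite rpred0.
apply/eqP; rewrite -subv0; apply/subvP => u; rewrite memv_cap.
case/andP => /vlineP[a ->] acI; rewrite memv0.
have [->|a0] := eqVneq a 0; first by rewrite scale0r.
by have := memvZ a^-1 acI; rewrite scalerK // (negPf cN).
Qed.

(** * Skew-symmetric matrices *)

Lemma krylov_perp (R : realType) (n : nat) (B : 'M[R]_n) (c w u : 'cV[R]_n)
    (k : nat) :
  (forall i, dot w (B ^+ i *m c) = 0) -> u \in krylov B c k -> dot w u = 0.
Proof.
move=> perp uK; suff : (krylov B c k <= lker (mulL w^T))%VS.
  by move/subvP/(_ _ uK); rewrite memv_ker mulLE => /eqP wu; rewrite /dot wu mxE.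
apply/span_subvP => _ /mapP[i _ ->]; rewrite memv_ker mulLE; apply/eqP.
by apply/matrixP => p q; rewrite !ord1 [LHS]perp mxE.
Qed.

Lemma skew_ker_sqr (R : realType) (n : nat) (A : 'M[R]_n) (u : 'cV[R]_n) :
  A^T = - A -> A *m (A *m u) = 0 -> A *m u = 0.
Proof.
by move=> skew AAu; apply: mulmx_tr_eq0; rewrite skew mulNmx AAu oppr0.
Qed.

Lemma skew_gram (R : realType) (n : nat) (A : 'M[R]_n) :
  A^T = - A -> A^T *m A = - (A *m A).
Proof. by move=> ->; rewrite mulNmx. Qed.

Lemma skew_gram_comm (R : realType) (n : nat) (A : 'M[R]_n) (i : nat) :
  A^T = - A -> A *m (A^T *m A) ^+ i = (A^T *m A) ^+ i *m A.
Proof.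
move=> skew; apply: commrX.
by rewrite /GRing.comm skew_gram // mulrN mulNr [_ *m _]/(A * A) mulrA.
Qed.

Lemma gram_exp_tr (R : realType) (m n : nat) (A : 'M[R]_(m, n)) (i : nat) :
  ((A^T *m A) ^+ i)^T = (A^T *m A) ^+ i.
Proof.
elim: i => [|i IHi]; first by rewrite expr0 trmx1.
by rewrite exprS trmx_mul IHi trmx_mul trmxK -[RHS]exprS exprSr.
Qed.

Lemma skew_dot (R : realType) (n : nat) (A : 'M[R]_n) (u : 'cV[R]_n) :
  A^T = - A -> dot u (A *m u) = 0.
Proof.
move=> skew; have : dot u (A *m u) = - dot u (A *m u).
  by rewrite {1}dotC dot_mull skew mulNmx dotNr.
lra.
Qed.

Lemma skew_gram_perp (R : realType) (n : nat) (A : 'M[R]_n) (b : 'cV[R]_n)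
    (p q : nat) :
  A^T = - A ->
  dot ((A^T *m A) ^+ p *m b) (A *m ((A^T *m A) ^+ q *m b)) = 0.
Proof.
move=> skew; rewrite dot_mull gram_exp_tr.
have -> : (A^T *m A) ^+ p *m (A *m ((A^T *m A) ^+ q *m b)) =
          (A *m (A^T *m A) ^+ (p + q)) *m b.
  have expD : (A^T *m A) ^+ (p + q) = (A^T *m A) ^+ p *m (A^T *m A) ^+ q.
    exact: exprD.
  by rewrite expD !mulmxA skew_gram_comm.
apply: skew_dot.
by rewrite trmx_mul gram_exp_tr {2}skew mulmxN -skew_gram_comm.
Qed.

Lemma skew_krylov_perp (R : realType) (n : nat) (A : 'M[R]_n)
    (b u v : 'cV[R]_n) (i j : nat) :
  A^T = - A -> u \in krylov (A^T *m A) b i -> v \in krylov (A^T *m A) b j ->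
  dot u (A *m v) = 0.
Proof.
move=> skew uK vK; rewrite -[A]trmxK -dot_mull.
apply: (krylov_perp _ vK) => q; rewrite dot_mull trmxK dotC.
by apply: (krylov_perp _ uK) => p; rewrite dotC skew_gram_perp.
Qed.

(** Separation of the even from the odd powers of A; the even powers are, up to
    sign, the powers of the Gram matrix. *)
Lemma skew_krylov_split (R : realType) (n : nat) (A : 'M[R]_n) (b : 'cV[R]_n)
    (j : nat) (E := krylov (A^T *m A) b) : A^T = - A ->
  krylov A b j.*2 = (E j + mulL A @: E j)%VS /\
  krylov A b j.*2.+1 = (E j.+1 + mulL A @: E j)%VS.
Proof.
move=> skew.
have imgAA (U : {vspace 'cV[R]_n}) :
    (mulL A @: (mulL A @: U) = mulL (A^T *m A) @: U)%VS.
  by rewrite mulL_comp skew_gram // mulLN.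
have odd_of_even i : krylov A b i.*2 = (E i + mulL A @: E i)%VS ->
    krylov A b i.*2.+1 = (E i.+1 + mulL A @: E i)%VS.
  move=> IH; rewrite krylovS IH limgD imgAA /E krylovS.
  by rewrite -addvA; congr (_ + _)%VS; rewrite addvC.
suff even i : krylov A b i.*2 = (E i + mulL A @: E i)%VS.
  by split; [exact: even | apply/odd_of_even/even].
elim: i => [|i IH]; first by rewrite double0 /E !krylov0 limg0 addv0.
rewrite doubleS krylovS odd_of_even // limgD imgAA.
by rewrite [X in (_ + X)%VS = _]addvC addvA /E -krylovS.
Qed.

Lemma skew_krylov_normal (R : realType) (n : nat) (A : 'M[R]_n) (b : 'cV[R]_n)
    (j : nat) : A^T = - A ->
  krylov (A^T *m A) (A^T *m b) j = (mulL A @: krylov (A^T *m A) b j)%VS.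
Proof.
move=> skew; rewrite krylov_img; first by rewrite skew mulLN.
by rewrite skew !(mulNmx, mulmxN) mulmxA.
Qed.

(** The even component e of x adds A e to the residual, orthogonally to the
    contribution of b and of the odd component. *)
Lemma skew_minimizer_split (R : realType) (n : nat) (A : 'M[R]_n)
    (b x : 'cV[R]_n) (i j : nat) (E := krylov (A^T *m A) b) :
  A^T = - A -> min_residual A b (E j + mulL A @: E i)%VS x ->
  exists e o, [/\ x = e + o, e \in E j, A *m e = 0 &
                  min_residual A b (mulL A @: E i)%VS o].
Proof.
move=> skew [/memv_addP[e eE [o oO def_x]] xmin].
have odd_sub y : y \in (mulL A @: E i)%VS -> y \in (E j + mulL A @: E i)%VS.
  by apply/subvP/addvSr.
have Ae : A *m e = 0.
  (* Dropping e cannot decrease the residual. *)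
  have := xmin _ (odd_sub _ oO); rewrite ler_norm2 def_x mulmxDr opprD addrCA addrC.
  set r := b - A *m o; have rE : r \in E i.+1.
    case/memv_imgP: oO => w wE o_eq; rewrite /r o_eq mulLE mulmxA.
    rewrite -[A *m A]opprK -skew_gram // mulNmx opprK /E krylovS.
    by rewrite memv_add ?memv_line ?memv_mulL.
  have re : dot r (A *m e) = 0 by exact: skew_krylov_perp rE eE.
  move: re; move: r {rE} => r re.
  rewrite !(dotDl, dotDr, dotNl, dotNr) opprK re (dotC _ r) re => le_r.
  by apply/eqP; rewrite -dot_eq0 eq_le dot_ge0 andbT; lra.
exists e, o; split=> //; split=> // y yO.
by have := xmin _ (odd_sub _ yO); rewrite def_x mulmxDr Ae add0r.
Qed.

(** A vector of an even part lying in the kernel of A is zero as long as the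
    span of the odd Krylov vectors contains no least-squares solution. *)
Lemma skew_even_kernel (R : realType) (n : nat) (A : 'M[R]_n)
    (b e : 'cV[R]_n) (j : nat) (E := krylov (A^T *m A) b) :
  A^T = - A -> e \in E j.+1 -> A *m e = 0 -> e != 0 ->
  exists2 y, y \in (mulL A @: E j)%VS & least_squares A b y.
Proof.
move=> skew; rewrite /E krylovS.
case/memv_addP => _ /vlineP[c ->] [_ /memv_imgP[w wE ->] ->].
rewrite mulLE; have [->|c0] := eqVneq c 0.
  rewrite scale0r add0r skew_gram // mulNmx mulmxN -!mulmxA => /eqP.
  (* A G w = 0 forces G w = 0. *)
  rewrite oppr_eq0 => /eqP /(skew_ker_sqr skew) ->.
  by rewrite oppr0 eqxx.
move=> Ae _; exists (c^-1 *: (A *m w)); first by rewrite memvZ ?memv_mulL.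
apply: normal_eq_least_squares.
have -> : b - A *m (c^-1 *: (A *m w)) = c^-1 *: (c *: b + (A^T *m A) *m w).
  by rewrite skew_gram // mulNmx scalerDr scalerK // scalerN -scalemxAr mulmxA.
by rewrite -scalemxAr {1}skew mulNmx Ae oppr0 scaler0.
Qed.

(** Some odd Krylov subspace contains a least-squares solution: otherwise the
    even Krylov subspaces would grow forever. *)
Lemma skew_odd_least_squares (R : realType) (n : nat) (A : 'M[R]_n)
    (b : 'cV[R]_n) : A^T = - A ->
  exists j, exists2 y, y \in (mulL A @: krylov (A^T *m A) b j)%VS &
                       least_squares A b y.
Proof.
move=> skew; set G := A^T *m A; set E := krylov G b.
set found := exists j, _.
have grow j : found \/ (j <= \dim (E j))%N.
  elim: j => [|j [?|IHj]]; [by right | by left |].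
  have [/memv_imgP[w wE b_eq]|bN] := boolP (b \in (mulL G @: E j)%VS).
    (* If b = G w, then - A w solves the system exactly. *)
    left; exists j; exists (A *m (- w)); first by rewrite memv_mulL ?rpredN.
    apply: normal_eq_least_squares.
    by rewrite b_eq mulLE /G skew_gram // mulNmx !mulmxN opprK mulmxA addNr mulmx0.
  have [inj|] := eqVneq (E j :&: lker (mulL G))%VS 0%VS.
    by right; rewrite /E krylov_dim_growth.
  rewrite -vpick0; set e := vpick _ => e0; left; exists j.
  have : e \in (E j :&: lker (mulL G))%VS by apply: memv_pick.
  rewrite memv_cap memv_ker mulLE => /andP[eE /eqP Ge].
  apply: (skew_even_kernel skew _ _ e0).
    by move: eE; apply/subvP/krylov_leS.
  by apply: mulmx_tr_eq0; rewrite mulmxA.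
have [//|big] := grow n.+1.
have := leq_trans big (dimvS (subvf (E n.+1))).
by rewrite dimvf dim_matrix mulr1 ltnn.
Qed.

(** * S2MR and LSQR *)

Theorem proposition3 (R : realType) (n : nat) (A Adag : 'M[R]_n) (b : 'cV[R]_n)
    (xM xL : nat -> 'cV[R]_n)
    (A_neq0 : A != 0) (A_singular : A \notin unitmx) (A_skew : A^T = - A)
    (b_neq0 : b != 0) (Adag_pinv : is_pinv A Adag)
    (xM_S2MR : S2MR_iterates A b xM) (xL_LSQR : LSQR_iterates A b xL) :
  (forall j : nat, (1 <= j)%N -> xL j <> Adag *m b ->
     xM j.*2 = xM j.*2.+1 /\ xM j.*2.+1 = xL j) /\
  S2MR_returns A b xM (Adag *m b).
Proof.
pose E := krylov (A^T *m A) b; pose O j := (mulL A @: E j)%VS.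
have row_space j y : y \in O j -> exists z, y = A^T *m z.
  case/memv_imgP => w _ ->; exists (- w).
  by rewrite mulLE A_skew mulNmx mulmxN opprK.
have pinvE j y : y \in O j -> least_squares A b y -> y = Adag *m b.
  by case/row_space => z ->; apply: pinv_row_space_unique.
have E_leS j e : e \in E j -> e \in E j.+1 by apply/subvP/krylov_leS.
have split_even j : min_residual A b (E j + O j)%VS (xM j.*2).
  by rewrite -(skew_krylov_split b j A_skew).1.
have split_odd j : min_residual A b (E j.+1 + O j)%VS (xM j.*2.+1).
  by rewrite -(skew_krylov_split b j A_skew).2.
have O_sub i j y : y \in O j -> y \in (E i + O j)%VS.
  by apply/subvP/addvSr.
split=> [j _ xL_neq | ].
  have xL_min : min_residual A b (O j) (xL j).
    by rewrite /O -skew_krylov_normal.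
  have unique i x : min_residual A b (E i + O j)%VS x ->
      (E i <= E j.+1)%VS -> x = xL j.
    case/(skew_minimizer_split A_skew) => e [o [-> eE Ae o_min]] /subvP/(_ _ eE) {}eE.
    have -> : o = xL j.
      have [z o_xL] : exists z, o - xL j = A^T *m z.
        apply: (row_space j); apply: rpredB; [exact: o_min.1|exact: xL_min.1].
      apply/eqP; rewrite -subr_eq0 o_xL; apply/eqP/mulmx_tr_eq0.
      rewrite trmxK -o_xL mulmxBr.
      by rewrite (min_residual_image_unique o_min xL_min) subrr.
    have [->|e0] := eqVneq e 0; first by rewrite add0r.
    have [y yO yLS] := skew_even_kernel A_skew eE Ae e0.
    case: xL_neq; apply: (pinvE j); first exact: xL_min.1.
    exact: least_squares_min_residual yLS yO xL_min.
  rewrite (unique _ _ (split_odd j) (subvv _)).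
  by rewrite (unique _ _ (split_even j) (krylov_leS _ _ _)).
pose converged k := A *m xM k == A *m (Adag *m b).
(* All least-squares solutions have the same image under A. *)
have convergedP k : reflect (least_squares A b (xM k)) (converged k).
  have pinvLS := pinv_least_squares b Adag_pinv.
  apply: (iffP eqP) => [eq_res y|xLS]; first by rewrite eq_res.
  by apply: (@min_residual_image_unique _ _ A b _ _ fullv); apply/min_residual_fullv.
have ex_conv : exists k, converged k.
  have [j [y yO yLS]] := skew_odd_least_squares b A_skew.
  exists j.*2; apply/convergedP.
  exact: least_squares_min_residual yLS (O_sub j j y yO) (split_even j).
case: (ex_minnP ex_conv) => k /convergedP xLS k_min.
have even_bound j y : y \in O j -> least_squares A b y -> (k <= j.*2)%N.
  move=> yO yLS; apply/k_min/convergedP.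
  exact: least_squares_min_residual yLS (O_sub j j y yO) (split_even j).
exists k; split=> //.
  by move=> i ik /convergedP/k_min; rewrite leqNgt ik.
have drop_kernel e o : A *m e = 0 -> xM k = e + o -> least_squares A b o.
  by move=> Ae xk y; have := xLS y; rewrite xk mulmxDr Ae add0r.
have := odd_double_half k; case: (odd k) => /= [|]; set j := k./2 => k_eq.
  (* k = 2 j + 1: the odd component is a solution in the span of index 2 j. *)
  move: (split_odd j); rewrite -[j.*2.+1]/(1 + j.*2)%N k_eq.
  case/(skew_minimizer_split A_skew) => e [o [xk _ Ae [oO _]]].
  have := even_bound j o oO (drop_kernel e o Ae xk).
  by rewrite -k_eq add1n ltnn.
(* k = 2 j: a nonzero kernel component would yield a solution at 2 j - 2. *)
move: (split_even j); rewrite -[j.*2]add0n k_eq.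
case/(skew_minimizer_split A_skew) => e [o [xk eE Ae [oO _]]].
have oLS := drop_kernel e o Ae xk.
suff e0 : e = 0 by rewrite xk e0 add0r; apply/esym/(pinvE j).
apply/eqP/negPn/negP => e0.
case: j k_eq eE {oO} => [|i] k_eq eE.
  by move: eE e0; rewrite /E krylov0 memv0 => ->.
have [y yO yLS] := skew_even_kernel A_skew eE Ae e0.
by have := even_bound i y yO yLS; rewrite -k_eq add0n doubleS ltnNge leqnSn.
Qed.
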